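(* For all positive integers $k$ and $n$ and every real $x$, $$\sum_{j=0}^{n-k}(-1)^j\binom{n}{j}B_k^{n-j}(x)=(-1)^{n-k}\binom{n}{k}x^n,$$ where $B_k^n$ denotes the Bernstein basis function.
   Context: The Bernstein basis functions are $B_k^n(x)=\binom{n}{k}x^k(1-x)^{n-k}$ for integers $0\le k\le n$ (with $0^0=1$). If $n<k$ the sum is empty (equal to $0$) and $\binom{n}{k}=0$. *)

(* Defs.v *)
From HB Require Import structures.
From mathcomp Require Import all_boot all_order all_algebra.
From mathcomp Require Import reals.
Set Implicit Arguments.
Unset Strict Implicit.
Unset Printing Implicit Defensive.
Import Order.TTheory GRing.Theory Num.Theory.
Local Open Scope ring_scope.

(* The subtraction n - k truncates at 0, but for n < k the factor 'C(n, k)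
   vanishes. Since x ^+ 0 = 1 for every x, the convention 0^0 = 1 holds. *)
Definition bernstein (R : realType) (n k : nat) (x : R) : R :=
  'C(n, k)%:R * x ^+ k * (1 - x) ^+ (n - k).

(* Main.v *)
(* Since C(n,j) C(n-j,k) = C(n,k) C(n-k,j), the factor C(n,k) x^k comes out of
   the sum, and what remains is the binomial expansion of
   ((1 - x) - 1)^(n-k) = (-x)^(n-k). *)
Require Import Defs.
From HB Require Import structures.
From mathcomp Require Import all_boot all_order all_algebra.
From mathcomp Require Import reals ring.
Set Implicit Arguments.
Unset Strict Implicit.
Unset Printing Implicit Defensive.
Import Order.TTheory GRing.Theory Num.Theory.
Local Open Scope ring_scope.

(** Both sides count the ordered pairs of disjoint subsets of sizes [j] and [k] in an [n]-set;
    multiplied by [j! k! (n-j-k)!], each becomes [n!]. *)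
Lemma mul_bin_trinomial (n k j : nat) : (k + j <= n)%N ->
  ('C(n, j) * 'C(n - j, k) = 'C(n, k) * 'C(n - k, j))%N.
Proof.
move=> le_kj_n.
have [le_j_n le_k_n] : (j <= n)%N /\ (k <= n)%N.
  by split; apply: leq_trans le_kj_n; rewrite ?leq_addl ?leq_addr.
have le_k_nj : (k <= n - j)%N by rewrite leq_subRL // addnC.
have le_j_nk : (j <= n - k)%N by rewrite leq_subRL.
have fact_pos : (0 < j`! * (k`! * (n - j - k)`!))%N by rewrite !muln_gt0 !fact_gt0.
apply/eqP; rewrite -(eqn_pmul2r fact_pos); apply/eqP.
transitivity n`!.
  by rewrite mulnACA bin_fact // -mulnA bin_fact.
by rewrite [(j`! * _)%N]mulnCA subnAC mulnACA bin_fact // -mulnA bin_fact.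
Qed.

(* MathComp world. The range 0 <= j < n.+1 - k is j = 0, ..., n - k when k <= n
   and is empty when n < k; the exponent n - k on the right is an integer. *)
Theorem theorem13 (R : realType) (k n : nat) (hk : (0 < k)%N) (hn : (0 < n)%N)
    (x : R) :
  \sum_(0 <= j < n.+1 - k) (-1) ^+ j * 'C(n, j)%:R * bernstein (n - j) k x =
  (-1) ^ (n%:Z - k%:Z) * 'C(n, k)%:R * x ^+ n.
Proof.
have [lt_nk | le_kn] := ltnP n k.
  by rewrite big_geq ?leqn0 ?subn_eq0 // bin_small // mulr0 mul0r.
rewrite subzn // subSn // big_mkord.
have -> : x ^+ n = x ^+ k * x ^+ (n - k) by rewrite -exprD subnKC.
(* Here [- x] is kept as [(1 - x) - 1] so that [exprDn] yields powers of [1 - x] with the signs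
   [(-1) ^+ j], matching the sum term by term. *)
transitivity ('C(n, k)%:R * x ^+ k * ((1 - x) - 1) ^+ (n - k)); last first.
  by rewrite addrAC subrr add0r [(- x) ^+ _]exprNn -exprnP; ring.
rewrite exprDn mulr_sumr; apply: eq_bigr => j _.
have le_kj_n : (k + j <= n)%N by rewrite -leq_subRL // -ltnS.
rewrite /bernstein -mulr_natr subnAC.
have /(congr1 (fun i => i%:R : R)) := mul_bin_trinomial le_kj_n.
rewrite !natrM => trinom.
(* The two binomials are made adjacent so that [trinom] can replace their product. *)
transitivity ((-1) ^+ j * ('C(n, j)%:R * 'C(n - j, k)%:R) * x ^+ k
              * (1 - x) ^+ (n - k - j)); first by ring.
by rewrite trinom; ring.
Qed.
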